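(* Let $T$ be any proper binary tree with $\ell \geq 2$ leaves, and let $\mathbf{L} = (n_1, n_2, \ldots, n_k)$ be the binary power representation of $\ell$. Then $R(T) \leq R(T_{\mathbf{L}})$.
   Context: A proper binary tree is an unordered rooted tree in which every internal vertex has exactly two children. For a vertex $v$ of a rooted tree $T$, the rank (protection number) $R_T(v)$ is the minimum distance from $v$ to a leaf descendant of $v$ (a leaf has rank $0$), and the security of $T$ is $R(T) = \sum_{v \in V(T)} R_T(v)$. The binary power representation of $\ell$ is the vector $\mathbf{L} = (n_1, \ldots, n_k)$ with $\ell = \sum_{i=1}^k 2^{n_i}$ and $n_1 > n_2 > \cdots > n_k \geq 0$. The tree $T_{\mathbf{L}}$ is the proper binary tree rooted at $v_k$ constructed as follows: take a path $P = v_1 v_2 \ldots v_k$; identify $v_1$ with the root of a complete binary tree with $2^{n_1}$ leaves; and for each $2 \leq i \leq k$, join $v_i$ by an edge to the root $u_i$ of a complete binary tree with $2^{n_i}$ leaves. (Intuitively, $T_{\mathbf{L}}$ is a binary caterpillar whose $k$ pendant positions carry complete binary trees of heights $n_1, \ldots, n_k$, with the largest deepest.) *)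

(* Defs.v *)
From mathcomp Require Import all_boot.

Set Implicit Arguments.
Unset Strict Implicit.
Unset Printing Implicit Defensive.

(* A finite (unordered) rooted tree is given by its parent function. The root
   is made its own parent by convention, and iterating [parent] from any vertex
   reaches the root, which rules out any other cycle. *)
Record rtree := RTree {
  vertex :> finType;
  troot : vertex;
  parent : vertex -> vertex;
  parent_root : parent troot = troot;
  connect_root : forall v, fconnect parent v troot
}.

Section RootedTree.
Variable T : rtree.
Implicit Types v w : T.

Definition children v : {set T} :=
  [set w | (w != troot T) && (parent w == v)].

Definition is_leaf v := children v == set0.

Definition leaves : {set T} := [set v | is_leaf v].

Definition proper_binary := forall v, ~~ is_leaf v -> #|children v| = 2.

(* Reflexive: every vertex is a descendant of itself. *)
Definition descendant v w := fconnect (@parent T) w v.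

(* When [w] is a descendant of [v], the path from [w] to [v] climbs through
   successive parents, so its length is the index of [v] in the [parent]-orbit
   of [w]. *)
Definition dist_down v w := findex (@parent T) w v.

(* The default value [#|T|] is never attained: every vertex has a leaf
   descendant, and distances are smaller than [#|T|]. *)
Definition rank v :=
  \big[minn/#|T|]_(w in leaves | descendant v w) dist_down v w.

Definition security := \sum_(v : T) rank v.

End RootedTree.

Lemma single_connect (v : unit) : fconnect id v tt.
Proof. by case: v; apply: connect0. Qed.

Definition single : rtree := @RTree unit tt id erefl single_connect.

Section Join.
Variables T1 T2 : rtree.

(* [None] is a new root, whose two children are the roots of [T1] and [T2]. *)
Definition join_parent (v : option (T1 + T2)) : option (T1 + T2) :=
  match v with
  | None => None
  | Some (inl x) => if x == troot T1 then None else Some (inl (parent x))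
  | Some (inr y) => if y == troot T2 then None else Some (inr (parent y))
  end.

Lemma join_connect v : fconnect join_parent v None.
Proof.
have iterP (T : rtree) (g : T -> option (T1 + T2)) :
    (forall x, join_parent (g x) =
       if x == troot T then None else g (parent x)) ->
    forall x, fconnect join_parent (g x) None.
  move=> gP x; have /iter_findex := connect_root x.
  move: (findex (@parent T) x (troot T)) => n.
  elim: n x => [|n IHn] x => [/= xr|]; last rewrite iterSr => /IHn.
    by apply: connect1; rewrite /= gP xr eqxx.
  apply: connect_trans; case: (eqVneq x (troot T)) => [->|/negPf xN].
    by rewrite parent_root.
  by apply: connect1; rewrite /= gP xN.
case: v => [[x|y]|]; last exact: connect0.
- exact: (iterP T1 (fun x => Some (inl x))).
- exact: (iterP T2 (fun y => Some (inr y))).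
Qed.

Definition join : rtree :=
  @RTree (option (T1 + T2)) None join_parent erefl join_connect.

End Join.

(* The complete binary tree of height [n], with [2 ^ n] leaves. *)
Fixpoint complete n : rtree :=
  if n is m.+1 then join (complete m) (complete m) else single.

Definition binary_power_rep (l : nat) (L : seq nat) : Prop :=
  l = \sum_(n <- L) 2 ^ n /\ sorted gtn L.

(* The tree T_L for L = (n_1, ..., n_k), along the spine v_1 ... v_k: the root
   v_1 of the accumulated tree is that of the complete tree of height n_1, and
   each [join] adds a spine vertex v_i whose children are v_(i-1) and the root
   of the complete tree of height n_i. The value at the empty sequence is
   irrelevant, as the empty sequence represents no positive integer. *)
Definition tree_of (L : seq nat) : rtree :=
  if L is n1 :: L' then foldl (fun t n => join t (complete n)) (complete n1) L'
  else single.

(* Main.v *)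
(* Let w(l) be floor(log2 l) plus the number of ones in the binary expansion
   of l. A proper binary tree with l leaves has security at most 2l - w(l) - 1,
   with equality for T_L. For the bound, induct on the tree: a vertex whose
   children have a and b leaf descendants and ranks at least r, one of them
   equal to r, has rank r + 1, and 2^r <= a, b since a vertex of rank r has at
   least 2^r leaf descendants. So the induction step is the inequality
   w(a + b) + r <= w(a) + w(b) for 2^r <= a, b. Adding a and b in binary with
   carries, each of the lowest r bit positions contributes a slack of 1. *)

Require Import Defs.
From mathcomp Require Import all_boot zify.

Set Implicit Arguments.
Unset Strict Implicit.
Unset Printing Implicit Defensive.

(** * Arithmetic of the bit weight *)

(* With enough fuel this is the floor of the binary logarithm of [m] plus the
   number of ones in its binary expansion; it is [0] at [m = 0]. *)
Fixpoint bit_weight_rec (fuel m : nat) : nat :=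
  if fuel is fuel'.+1 then
    if m <= 1 then m else bit_weight_rec fuel' m./2 + odd m + 1
  else 0.

Definition bit_weight (m : nat) : nat := bit_weight_rec m m.

Lemma bit_weight_rec_fuel (fuel m : nat) :
  m <= fuel -> bit_weight_rec fuel m = bit_weight m.
Proof.
rewrite /bit_weight; elim/ltn_ind: m fuel => m IHm [|fuel] /=.
  by rewrite leqn0 => /eqP->.
move=> m_le; case: m => [|m] //= in IHm m_le *.
case: ifP => // m_gt0; rewrite IHm ?(IHm _ _ m) //; lia.
Qed.

Lemma bit_weight_half (m : nat) :
  1 < m -> bit_weight m = bit_weight m./2 + odd m + 1.
Proof.
case: m => // m m_gt0; rewrite {1}/bit_weight /=.
rewrite leqNgt m_gt0 /= bit_weight_rec_fuel //; lia.
Qed.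

Lemma bit_weightS (m : nat) : bit_weight m.+1 <= (bit_weight m).+1.
Proof.
elim/ltn_ind: m => -[|[|m]] // IHm.
rewrite bit_weight_half // (@bit_weight_half m.+2) //.
have [m_odd|m_even] := boolP (odd m).
  have -> : m.+3./2 = m.+2./2.+1 by lia.
  have := IHm m.+2./2; lia.
have -> : m.+3./2 = m.+2./2 by lia.
lia.
Qed.

(* [c] is the carry into the lowest bit of [a + b], and [c'] the carry out. *)
Lemma bit_weight_carry (a b : nat) (c : bool) :
  1 < a -> 1 < b ->
  exists c' : bool,
    bit_weight (a + b + c) + c' + bit_weight a./2 + bit_weight b./2 + 1
      <= bit_weight (a./2 + b./2 + c') + bit_weight a + bit_weight b + c.
Proof.
move=> a_gt1 b_gt1; exists (1 < odd a + odd b + c).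
have -> : bit_weight (a + b + c) =
    bit_weight (a + b + c)./2 + odd (a + b + c) + 1.
  by apply: bit_weight_half; lia.
rewrite (bit_weight_half a_gt1) (bit_weight_half b_gt1).
have -> : (a + b + c)./2 = a./2 + b./2 + (1 < odd a + odd b + c).
  have := odd_double_half a; have := odd_double_half b.
  by case: (odd a); case: (odd b); case: c => /=; lia.
(* The three low bits sum to [2 * c'] plus the low bit of [a + b + c]. Halving costs 1 in each of
   [a] and [b] but only once in the sum, so the two sides differ by exactly [c']. *)
by rewrite !oddD; case: (odd a); case: (odd b); case: c => /=; lia.
Qed.

(** The carry [c] is there for the induction, which halves both summands and stops when one of them
    is 1; that case is two uses of [bit_weightS] at most. *)
Lemma bit_weight_add (a b : nat) (c : bool) :
  0 < a -> 0 < b -> bit_weight (a + b + c) <= bit_weight a + bit_weight b + c.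
Proof.
elim/ltn_ind: a b c => a IHa b c a_gt0 b_gt0.
have one x : bit_weight (x + 1 + c) <= bit_weight x + 1 + c.
  have := bit_weightS x; have := bit_weightS x.+1.
  by case: c; rewrite addn1 ?addn1 ?addn0; lia.
case: (ltngtP 1 a) a_gt0 => // [a_gt1 _|<- _]; last first.
  by rewrite (addnC 1) (addnC (bit_weight 1)); apply: one.
case: (ltngtP 1 b) b_gt0 => // [b_gt1 _|<- _]; last exact: one.
have [c'] := bit_weight_carry c a_gt1 b_gt1.
have := IHa a./2 _ b./2 c'; lia.
Qed.

(** Both summands survive [r] halvings, each of which gains the 1 in [bit_weight_carry];
    subadditivity handles what is left. *)
Lemma bit_weight_add_exp (r a b : nat) (c : bool) :
  2 ^ r <= a -> 2 ^ r <= b ->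
  bit_weight (a + b + c) + r <= bit_weight a + bit_weight b + c.
Proof.
elim: r a b c => [|r IHr] a b c; first by rewrite addn0; apply: bit_weight_add.
have := expn_gt0 2 r; rewrite expnS => r_gt0 ra rb.
have [||c'] := @bit_weight_carry a b c; try lia.
have := IHr a./2 b./2 c'; lia.
Qed.

Lemma bit_weight_exp_mul (k m : nat) :
  0 < m -> bit_weight (2 ^ k * m) = bit_weight m + k.
Proof.
move=> m_gt0; elim: k => [|k IHk]; first by rewrite mul1n addn0.
have := expn_gt0 2 k => k_gt0.
rewrite expnS -mulnA mul2n bit_weight_half; last nia.
rewrite doubleK odd_double IHk; lia.
Qed.

Lemma sorted_gtn_rcons (s : seq nat) (m : nat) :
  sorted gtn (rcons s m) = all (fun n => m < n) s && sorted gtn s.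
Proof.
have gtn_trans : transitive gtn by move=> y x z /= yx zy; apply: ltn_trans yx.
by rewrite !sorted_pairwise // pairwise_rcons.
Qed.

(** The shift [k] makes induction from the right possible: all exponents before the least one, [m],
    exceed [m], so they can be shifted by [m.+1]. At [k = 0] this says that the logarithm is [n] and
    that each exponent gives one binary digit 1. *)
Lemma bit_weight_binary (n : nat) (L : seq nat) (k : nat) :
  sorted gtn (n :: L) -> k <= last n L ->
  bit_weight (\sum_(m <- n :: L) 2 ^ (m - k)) = n - k + (size L).+1.
Proof.
elim/last_ind: L k => [|L m IHL] k.
  by rewrite big_seq1 /= -[2 ^ _]muln1 => _ _; rewrite bit_weight_exp_mul // addnC.
rewrite -rcons_cons sorted_gtn_rcons.
rewrite last_rcons size_rcons => /andP[/allP /= m_lt sL] km.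
have n_gt : m < n by apply: m_lt; rewrite mem_head.
have last_gt : m < last n L by apply: m_lt; rewrite mem_last.
rewrite -rcons_cons big_rcons /=.
(* With the last term added, the sum becomes [2 ^ (m - k)] times the odd number [2 * s + 1]. *)
have -> : \sum_(x <- n :: L) 2 ^ (x - k) =
    2 ^ (m - k) * (\sum_(x <- n :: L) 2 ^ (x - m.+1)).*2.
  rewrite -mul2n mulnA -expnSr big_distrr /=; apply: eq_big_seq => x /m_lt mx.
  by rewrite -expnD; congr (2 ^ _); lia.
set s := \sum_(x <- _) _; have s_gt0 : 0 < s.
  by rewrite /s big_cons addn_gt0 expn_gt0.
rewrite -mulnSr bit_weight_exp_mul // bit_weight_half; last lia.
rewrite /= uphalf_double odd_double IHL //=; lia.
Qed.

(** * Descendants, distances and ranks in a rooted tree *)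

Section Tree.
Variable T : rtree.
Implicit Types u v w c : T.

Lemma in_children v w : (w \in children v) = (w != troot T) && (parent w == v).
Proof. by rewrite inE. Qed.

Lemma child_descendant v w : w \in children v -> descendant v w.
Proof. rewrite in_children => /andP[_ /eqP <-]; exact: fconnect1. Qed.

Lemma descendant_trans u v w : descendant u v -> descendant v w -> descendant u w.
Proof. by move=> uv vw; apply: connect_trans vw uv. Qed.

(** Otherwise [c] would be periodic under [parent]. Repeating the period as many times as there are
    steps from [c] to the root leads both back to [c] and to the root, yet a child is not the
    root. *)
Lemma child_not_ancestor v c : c \in children v -> ~~ descendant c v.
Proof.
rewrite in_children => /andP[/eqP c_nroot /eqP <-]; apply/negP=> /iter_findex.
set k := findex _ _ _; rewrite -iterSr => c_per; apply: c_nroot.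
have /iter_findex <- := Defs.connect_root c; set d := findex _ _ _.
have <- : iter (d * k.+1) (@parent T) c = c by rewrite iterM iter_fix.
have /iter_findex c_root := Defs.connect_root c; rewrite -/d in c_root.
by rewrite mulnC mulSn addnC iterD c_root !iter_fix ?parent_root.
Qed.

Lemma descendant_child v w :
  descendant v w = (w == v) || [exists c in children v, descendant c w].
Proof.
apply/idP/idP; last first.
  case/predU1P => [->|/exists_inP[c /child_descendant]]; first exact: connect0.
  exact: descendant_trans.
move/iter_findex; move: (findex (@parent T) w v) => m.
elim: m w => [w /= -> | m IHm w]; first by rewrite eqxx.
rewrite iterSr => /IHm /predU1P[pw|/exists_inP[c c_v cw]]; last first.
  apply/orP; right; apply/exists_inP; exists c => //.
  exact: connect_trans (fconnect1 _ _) cw.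
have [//|/= w_v] := eqVneq w v.
apply/exists_inP; exists w; last exact: connect0.
rewrite in_children pw eqxx andbT; apply: contra_neq w_v => wr.
by rewrite -pw wr parent_root.
Qed.

(** Induction on the number of descendants, which drops strictly from [v] to a child because [v]
    does not lie below its child. *)
Lemma children_ind (P : T -> Prop) :
  (forall v, (forall c, c \in children v -> P c) -> P v) -> forall v, P v.
Proof.
move=> Pstep v; have [m] := ubnP #|[set w | descendant v w]|.
elim: m v => // m IHm v /ltnSE D_lt; apply: Pstep => c c_v; apply: IHm.
apply: leq_trans D_lt; apply: proper_card; apply/properP; split.
  apply/subsetP=> w; rewrite !inE; apply: descendant_trans.
  exact: child_descendant.
exists v; rewrite inE; first exact: connect0.
exact: child_not_ancestor.
Qed.

Lemma descendant_leaf v w : is_leaf v -> descendant v w = (w == v).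
Proof.
move=> /eqP leaf_v; rewrite descendant_child leaf_v; case: eqP => //= _.
by apply/existsP => -[c]; rewrite inE.
Qed.

(** The climb from [w] meets [c] before [v], since [c] is not an ancestor of [v]; then [v] is one
    step further. *)
Lemma dist_down_child v c w :
  c \in children v -> descendant c w -> dist_down v w = (dist_down c w).+1.
Proof.
move=> c_v; rewrite /dist_down; have [k] := ubnP (findex (@parent T) w c).
elim: k w => // k IHk w /ltnSE le_k cw.
have v_w : v != w.
  by apply: contraTneq cw => <-; apply: child_not_ancestor.
have vw := descendant_trans (child_descendant c_v) cw.
rewrite fconnect_findex //; have [cw_eq|c_w] := eqVneq c w.
  move: c_v; rewrite -cw_eq in_children => /andP[_ /eqP ->].
  by rewrite !findex0.
have w_step := fconnect_findex cw c_w; rewrite w_step IHk //; first by lia.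
by move: cw; rewrite /descendant fconnect_eqVf eq_sym (negPf c_w).
Qed.

Lemma leaf_descendant v : exists2 w, is_leaf w & descendant v w.
Proof.
elim/children_ind: v => v IHv; have [leaf_v|] := boolP (is_leaf v).
  by exists v => //; apply: connect0.
case/set0Pn => c c_v; have [w leaf_w cw] := IHv c c_v.
by exists w => //; apply: descendant_trans cw; apply: child_descendant.
Qed.

Lemma rank_le_dist v w : is_leaf w -> descendant v w -> rank v <= dist_down v w.
Proof.
move=> leaf_w vw; rewrite /rank.
elim: (index_enum T) (mem_index_enum w) => //= u s IHs; rewrite inE big_cons.
have [<- _|_ /= /IHs le_w] := eqVneq w u; first by rewrite inE leaf_w vw geq_minl.
by case: ifP => // _; apply: leq_trans (geq_minr _ _) le_w.
Qed.

Lemma rank_attained v :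
  exists w, [/\ is_leaf w, descendant v w & rank v = dist_down v w].
Proof.
have [w0 leaf_w0 vw0] := leaf_descendant v.
have lt_rank : rank v < #|T|.
  apply: leq_ltn_trans (rank_le_dist leaf_w0 vw0) _.
  by apply: leq_trans (findex_max vw0) (max_card _).
(* The iterated minimum is either its default value or one of its terms, and [lt_rank] excludes the
   default. *)
suff: rank v = #|T| \/
    exists w, [/\ is_leaf w, descendant v w & rank v = dist_down v w].
  by case=> // eq_rank; rewrite eq_rank ltnn in lt_rank.
rewrite {1 2}/rank; elim/big_ind: _ => [|x y IHx IHy|w]; first by left.
  by rewrite /minn; case: ifP.
by rewrite inE => /andP[leaf_w vw]; right; exists w.
Qed.

Lemma rank_leaf v : is_leaf v -> rank v = 0.
Proof.
move=> leaf_v; apply/eqP; rewrite -leqn0 -(findex0 (@parent T) v).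
by apply: rank_le_dist => //; apply: connect0.
Qed.

Lemma rank_le_child v c : c \in children v -> rank v <= (rank c).+1.
Proof.
move=> c_v; have [w [leaf_w cw ->]] := rank_attained c.
rewrite -(dist_down_child c_v cw); apply: rank_le_dist => //.
by apply: descendant_trans cw; apply: child_descendant.
Qed.

Lemma rank_eq_child v :
  ~~ is_leaf v -> exists2 c, c \in children v & rank v = (rank c).+1.
Proof.
move=> Nleaf_v; have [w [leaf_w vw rank_v]] := rank_attained v.
have := vw; rewrite descendant_child => /predU1P[w_v|].
  by rewrite -w_v leaf_w in Nleaf_v.
case/exists_inP=> c c_v cw; exists c => //; apply/eqP.
rewrite eqn_leq rank_le_child //= rank_v (dist_down_child c_v cw) ltnS.
exact: rank_le_dist.
Qed.

Lemma rank_children v a b :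
  children v = [set a; b] -> rank v = (minn (rank a) (rank b)).+1.
Proof.
move=> ch_v; have a_v : a \in children v by rewrite ch_v !inE eqxx.
have b_v : b \in children v by rewrite ch_v !inE eqxx orbT.
have := rank_le_child a_v; have := rank_le_child b_v.
have [|c] := @rank_eq_child v; first by apply/set0Pn; exists a.
by rewrite ch_v !inE => /orP[]/eqP->; lia.
Qed.

End Tree.

(** * Ranks and security in a join *)

(** Rank depends only on what lies below a vertex. The hypothesis concerns children alone, so [f]
    may send the root to an inner vertex, as the inclusions into a join do. *)
Lemma rank_embedding (T1 T2 : rtree) (f : T1 -> T2) :
  (forall x, children (f x) = f @: children x) ->
  forall x, rank (f x) = rank x.
Proof.
move=> ch_f; elim/children_ind => x IHx.
have leaf_f : is_leaf (f x) = is_leaf x by rewrite /is_leaf ch_f imset_eq0.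
have [leaf_x|Nleaf_x] := boolP (is_leaf x).
  by rewrite !rank_leaf ?leaf_f.
apply/eqP; rewrite eqn_leq; apply/andP; split.
  have [c c_x ->] := rank_eq_child Nleaf_x; rewrite -IHx //.
  by apply: rank_le_child; rewrite ch_f imset_f.
have [|fc] := @rank_eq_child T2 (f x); first by rewrite leaf_f.
rewrite ch_f => /imsetP[c c_x ->] ->; rewrite IHx //; exact: rank_le_child.
Qed.

Section Join.
Variables T1 T2 : rtree.

Lemma children_join_root :
  children (troot (join T1 T2)) =
  [set (Some (inl (troot T1)) : join T1 T2); Some (inr (troot T2))].
Proof.
have eq_root (T : rtree) (g : T -> T1 + T2) x :
    injective g -> (Some (g x) == Some (g (troot T))) = (x == troot T).
  by move=> g_inj; rewrite -(inj_eq g_inj).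
apply/setP => -[[x|x]|]; rewrite in_children !inE //=.
- by rewrite (eq_root T1) ?orbF; [case: ifP | apply: inl_inj].
- by rewrite (eq_root T2); [case: ifP | apply: inr_inj].
Qed.

Lemma children_joinl (x : T1) :
  children (Some (inl x) : join T1 T2) =
  [set (Some (inl z) : join T1 T2) | z in children x].
Proof.
apply/setP => -[[z|z]|]; rewrite in_children /=.
- rewrite mem_imset; last by move=> ? ? [].
  by rewrite in_children; case: ifP.
- by case: ifP => _; apply/esym/imsetP => -[].
- by apply/esym/imsetP => -[].
Qed.

Lemma children_joinr (x : T2) :
  children (Some (inr x) : join T1 T2) =
  [set (Some (inr z) : join T1 T2) | z in children x].
Proof.
apply/setP => -[[z|z]|]; rewrite in_children /=.
- by case: ifP => _; apply/esym/imsetP => -[].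
- rewrite mem_imset; last by move=> ? ? [].
  by rewrite in_children; case: ifP.
- by apply/esym/imsetP => -[].
Qed.

Lemma rank_joinl (x : T1) : rank (Some (inl x) : join T1 T2) = rank x.
Proof.
exact: (@rank_embedding T1 (join T1 T2) (fun z => Some (inl z)) children_joinl).
Qed.

Lemma rank_joinr (x : T2) : rank (Some (inr x) : join T1 T2) = rank x.
Proof.
exact: (@rank_embedding T2 (join T1 T2) (fun z => Some (inr z)) children_joinr).
Qed.

Lemma rank_join_root :
  rank (troot (join T1 T2)) = (minn (rank (troot T1)) (rank (troot T2))).+1.
Proof. by rewrite (rank_children children_join_root) rank_joinl rank_joinr. Qed.

Lemma security_join :
  security (join T1 T2) =
  security T1 + security T2 + rank (troot (join T1 T2)).
Proof.
rewrite /security (bigD1 (troot (join T1 T2))) //= addnC; congr (_ + _).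
rewrite (reindex_omap (Some : T1 + T2 -> join T1 T2) id) /=; last by case.
rewrite (eq_bigl xpredT); last by move=> x; rewrite eqxx.
rewrite big_sumType /=; congr (_ + _); apply: eq_bigr => x _.
  exact: rank_joinl.
exact: rank_joinr.
Qed.

End Join.

(** * Security of complete trees and of [tree_of L] *)

Lemma rank_complete n : rank (troot (complete n)) = n.
Proof.
elim: n => [|n IHn]; last by rewrite rank_join_root IHn minnn.
by apply: rank_leaf; apply/eqP/setP=> -[]; rewrite !inE.
Qed.

(** There are [2 ^ (n - j)] vertices of rank [j], and the sum of [j * 2 ^ (n - j)] is
    [2 ^ n.+1 - n - 2]. *)
Lemma security_complete n : security (complete n) + n + 2 = 2 ^ n.+1.
Proof.
elim: n => [|n IHn]; last first.
  rewrite [complete n.+1]/= security_join -/complete (rank_complete n.+1).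
  by rewrite expnS -IHn; lia.
rewrite /security big1 // => v _.
by apply: rank_leaf; apply/eqP/setP=> -[]; rewrite !inE; case: v.
Qed.

Lemma tree_of_rcons n L m :
  tree_of (n :: rcons L m) = join (tree_of (n :: L)) (complete m).
Proof. by rewrite /= foldl_rcons. Qed.

(** The rank bound ensures that, when a smaller exponent [m] is appended, the new complete tree
    attains the minimum at the new root, which thus has rank [m.+1]. Together with the
    [2 ^ m.+1 - m - 2] of the complete tree, the security grows by [2 * 2 ^ m - 1]. *)
Lemma security_tree_of n L :
  sorted gtn (n :: L) ->
  last n L <= rank (troot (tree_of (n :: L))) /\
  security (tree_of (n :: L)) + n + (size L).+2 =
    2 * \sum_(m <- n :: L) 2 ^ m.
Proof.
elim/last_ind: L => [|L m IHL].
  rewrite big_seq1 -expnS -security_complete [tree_of _]/= rank_complete.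
  by rewrite /= addn2.
rewrite -rcons_cons sorted_gtn_rcons.
move=> /andP[/allP m_lt /IHL [last_rank sec_L]].
have last_gt : m < last n L := m_lt _ (mem_last n L).
rewrite rcons_cons tree_of_rcons security_join rank_join_root rank_complete.
rewrite -rcons_cons big_rcons last_rcons size_rcons.
have := security_complete m; rewrite expnS.
move: (tree_of (n :: L)) last_rank sec_L => t last_rank sec_L /=; lia.
Qed.


(** * The upper bound for proper binary trees *)

Section Bound.
Variable T : rtree.
Implicit Types u v w c : T.

Definition subtree v : {set T} := [set w | descendant v w].

Lemma in_subtree v w : (w \in subtree v) = descendant v w.
Proof. by rewrite inE. Qed.

Lemma subtree_leaf v : is_leaf v -> subtree v = [set v].
Proof.
by move=> leaf_v; apply/setP=> w; rewrite in_subtree inE descendant_leaf.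
Qed.

Lemma subtree_children v a b :
  children v = [set a; b] -> subtree v = v |: (subtree a :|: subtree b).
Proof.
move=> ch_v; apply/setP=> w; rewrite !inE descendant_child ch_v.
congr (_ || _); apply/exists_inP/orP => [[c]|].
  by rewrite !inE => /orP[]/eqP->; [left | right].
by case; [exists a | exists b]; rewrite // !inE eqxx ?orbT.
Qed.

(** A common descendant [w] would be equally far from [a] and [b], so both would be the same
    iterated parent of [w]. *)
Lemma disjoint_siblings v a b :
  a \in children v -> b \in children v -> a != b ->
  [disjoint subtree a & subtree b].
Proof.
move=> a_v b_v a_b; rewrite -setI_eq0; apply/eqP/setP=> w; rewrite !inE.
apply/negP => /andP[aw bw]; have := dist_down_child a_v aw.
rewrite (dist_down_child b_v bw) => -[dist_ab]; case/eqP: a_b.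
by rewrite -(iter_findex aw) -(iter_findex bw) [findex _ _ b]dist_ab.
Qed.

Lemma sum_subtree (F : T -> nat) v a b :
  children v = [set a; b] -> a != b ->
  \sum_(w in subtree v) F w =
  F v + (\sum_(w in subtree a) F w + \sum_(w in subtree b) F w).
Proof.
move=> ch_v a_b; have a_v : a \in children v by rewrite ch_v !inE eqxx.
have b_v : b \in children v by rewrite ch_v !inE eqxx orbT.
rewrite (subtree_children ch_v) big_setU1 /=; last first.
  by rewrite !inE !(negPf (child_not_ancestor _)).
congr (_ + _); rewrite -bigU ?(disjoint_siblings a_v b_v) //.
by apply: eq_bigl => w; rewrite !inE.
Qed.

(** The two claims are proved together because the exponential lower bound on the leaf counts of the
    children is what [bit_weight_add_exp] requires. *)
Lemma security_subtree_bound (v : T) : proper_binary T ->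
  let l := \sum_(w in subtree v) is_leaf w in
  2 ^ rank v <= l /\
  \sum_(w in subtree v) rank w + bit_weight l + 1 <= 2 * l.
Proof.
move=> binT; elim/children_ind: v => v IHv /=.
have [leaf_v|Nleaf_v] := boolP (is_leaf v).
  by rewrite subtree_leaf // !big_set1 leaf_v rank_leaf.
have /eqP/cards2P[a [b [a_b ch_v]]] := binT v Nleaf_v.
have [|exp_a le_a] := IHv a; first by rewrite ch_v !inE eqxx.
have [|exp_b le_b] := IHv b; first by rewrite ch_v !inE eqxx orbT.
rewrite !(sum_subtree _ ch_v a_b) (negPf Nleaf_v) add0n (rank_children ch_v).
set la := \sum_(w in subtree a) is_leaf w in exp_a le_a *.
set lb := \sum_(w in subtree b) is_leaf w in exp_b le_b *.
set r := minn _ _.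
have ra : 2 ^ r <= la.
  by apply: leq_trans exp_a; rewrite leq_exp2l // geq_minl.
have rb : 2 ^ r <= lb.
  by apply: leq_trans exp_b; rewrite leq_exp2l // geq_minr.
(* Of the rank [r.+1] of [v], the part [r] is paid by the gain in bit weight and the remaining 1 by
   the constants 1 of the two children merging into one. *)
have := bit_weight_add_exp false ra rb; rewrite expnS addn0; lia.
Qed.

Lemma security_bound :
  proper_binary T ->
  security T + bit_weight #|leaves T| + 1 <= 2 * #|leaves T|.
Proof.
move=> binT; have [_] := security_subtree_bound (troot T) binT.
have -> : subtree (troot T) = setT.
  by apply/setP=> w; rewrite !inE; apply: Defs.connect_root.
have -> : \sum_(w in [set: T]) is_leaf w = #|leaves T|.
  rewrite -sum1_card [RHS]big_mkcond; apply: eq_big => [w|w _]; rewrite inE //.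
have -> // : \sum_(w in [set: T]) rank w = security T.
by apply: eq_bigl => w; rewrite inE.
Qed.

End Bound.

Theorem theorem2p2 (T : rtree) (l : nat) (L : seq nat)
  (hT : proper_binary T) (hl : #|leaves T| = l) (hl2 : 2 <= l)
  (hL : binary_power_rep l L) :
  security T <= security (tree_of L).
Proof.
have := security_bound hT; rewrite hl; case: hL.
case: L => [|n L]; first by rewrite big_nil => l0; rewrite l0 in hl2.
move=> -> sL; have [_ sec_L] := security_tree_of sL.
(* The bit weight of [l] is [n + (size L).+1], so [sec_L] says that [tree_of (n :: L)] attains the
   upper bound. *)
have := bit_weight_binary sL (leq0n _); rewrite subn0.
under eq_bigr do rewrite subn0.
by move=> ->; lia.
Qed.
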